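(* Let $(G_N)_{N\in\mathbb N}$ be an increasing sequence of compact groups of $*$-automorphisms of a $C^*$-algebra $\mathcal A$, let $G=\bigcup_N G_N$ (a separable locally compact group), and let $\varphi$ be a faithful $G$-strongly quasi-invariant state on $\mathcal A$, with GNS representation $(\mathcal H,\pi,\Phi)$ and $\mathfrak A=\pi(\mathcal A)''$. Let $P_N=\int_{G_N}U_g\,dg$, $P_G=\text{s-}\lim_N P_N$, $\Phi_G=P_G\Phi$, and suppose $\Phi_G\ne 0$. Let $\psi_G(\cdot)=\|\Phi_G\|^{-2}\langle\Phi_G,\,\cdot\,\Phi_G\rangle$ on $\mathfrak A$ and $$E_N(x):=\int_{G_N}u_g(x)\,dg,\qquad x\in\mathfrak A.$$ Then $\psi_G\circ E_N=\psi_G$ for all $N$, and the sequence $(E_N)_N$ satisfies the martingale property: for all $M\le N$, $$E_NE_M=E_ME_N=E_N .$$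
   Context: A faithful state $\varphi$ on $\mathcal A$ is $G$-strongly quasi-invariant if for every $g\in G$ there is a self-adjoint $x_g\in\mathcal A$ with $\varphi(g(a))=\varphi(x_g a)$ for all $a\in\mathcal A$. (It is known that then each $x_g$ is strictly positive, lies in the centralizer of $\varphi$, and the $x_g$ commute with each other.) The formula $U_g\pi(a)\Phi=\pi(g(a)x_{g^{-1}}^{1/2})\Phi$ $(a\in\mathcal A)$ defines a unitary representation $g\mapsto U_g$ of $G$ on $\mathcal H$. On $\mathfrak A$ put $u_g(x)=U_g x U_g^*$; these are $*$-automorphisms of $\mathfrak A$ with $u_g(\pi(a))=\pi(g(a))$. Standing assumptions: on each $G_N$ the map $g\mapsto x_g\in\mathcal A$ is continuous and $g\mapsto U_g$ is strongly continuous. Integrals over $G_N$ are with respect to normalized Haar measure. The $P_N$ form a decreasing sequence of orthogonal projections, so the strong limit $P_G$ exists. *)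

(* Defs.v *)
From HB Require Import structures.
From mathcomp Require Import all_boot all_order all_algebra.
From mathcomp Require Import all_classical all_reals all_analysis.
From mathcomp Require Import complex.

Set Implicit Arguments.
Unset Strict Implicit.
Unset Printing Implicit Defensive.
Import Order.TTheory GRing.Theory Num.Theory.
Import numFieldNormedType.Exports.
Local Open Scope classical_set_scope.
Local Open Scope complex_scope.
Local Open Scope ring_scope.

(* Unital C*-algebras.  A C*-algebra carrying a strongly quasi-invariant
   faithful state is automatically unital: x_1 is a unit.  The product is a
   field of the mixin because no structure can inherit from both a ring and a
   normed module (such a join would sit below numDomainType). *)
HB.mixin Record isCStarAlgebra (R : realType) A
    of CompleteNormedModule R[i] A := {
  amul : A -> A -> A;
  aone : A;
  star : A -> A;
  amulA : forall a b c : A, amul a (amul b c) = amul (amul a b) c;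
  amul1a : forall a : A, amul aone a = a;
  amula1 : forall a : A, amul a aone = a;
  amulDl : forall a b c : A, amul (a + b) c = amul a c + amul b c;
  amulDr : forall a b c : A, amul a (b + c) = amul a b + amul a c;
  amulZl : forall (z : R[i]) (a b : A), amul (z *: a) b = z *: amul a b;
  amulZr : forall (z : R[i]) (a b : A), amul a (z *: b) = z *: amul a b;
  starD : forall a b : A, star (a + b) = star a + star b;
  starZ : forall (z : R[i]) (a : A), star (z *: a) = z^* *: star a;
  starM : forall a b : A, star (amul a b) = amul (star b) (star a);
  starK : forall a : A, star (star a) = a;
  cstar_normM : forall a b : A, `|amul a b| <= `|a| * `|b|;
  cstar_normE : forall a : A, `|amul (star a) a| = `|a| ^+ 2;
}.

#[short(type="cstarAlgType")]
HB.structure Definition CStarAlgebra (R : realType) :=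
  { A of isCStarAlgebra R A & CompleteNormedModule R[i] A }.

Notation "a ** b" := (amul a b) (at level 40, left associativity) : ring_scope.

(* The inner product is linear in its second argument.  The norm of a normed
   module over R[i] takes its values in R[i]; inner_norm makes it the norm of
   the inner product, which also gives positive definiteness. *)
HB.mixin Record isHilbert (R : realType) H of CompleteNormedModule R[i] H := {
  inner : H -> H -> R[i];
  innerDr : forall u v w : H, inner u (v + w) = inner u v + inner u w;
  innerZr : forall (z : R[i]) (u v : H), inner u (z *: v) = z * inner u v;
  innerC : forall u v : H, inner v u = (inner u v)^*;
  inner_norm : forall u : H, inner u u = `|u| ^+ 2;
}.

#[short(type="hilbertType")]
HB.structure Definition Hilbert (R : realType) :=
  { H of isHilbert R H & CompleteNormedModule R[i] H }.

HB.mixin Record isTopologicalGroup G of Group G & PointedTopological G := {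
  mulg_continuous : continuous (fun p : G * G => (p.1 * p.2)%g);
  invg_continuous : continuous (fun g : G => (g^-1)%g);
}.

#[short(type="topologicalGroupType")]
HB.structure Definition TopologicalGroup :=
  { G of isTopologicalGroup G & Group G & PointedTopological G }.

Definition separable (T : topologicalType) : Prop :=
  exists2 D : set T, countable D & dense D.

Definition subgroup (G : groupType) (K : set G) : Prop :=
  [/\ K 1%g, (forall g h, K g -> K h -> K (g * h)%g)
    & (forall g, K g -> K (g^-1)%g)].

Section CStarAlgebras.
Context {R : realType} {A : cstarAlgType R}.

Definition cpositive (a : A) : Prop := exists b : A, a = star b ** b.

(* the unique positive square root of a positive element *)
Definition csqrt (a : A) : A := xget 0 [set s | cpositive s /\ s ** s = a].

Definition is_state (phi : {scalar A}) : Prop :=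
  (forall a, 0 <= phi (star a ** a)) /\ phi aone = 1.

Definition faithful (phi : {scalar A}) : Prop :=
  forall a, phi (star a ** a) = 0 -> a = 0.

Definition star_automorphism (f : A -> A) : Prop :=
  [/\ bijective f, linear f, (forall a b, f (a ** b) = f a ** f b)
    & (forall a, f (star a) = star (f a))].

(* alpha identifies the abstract group G with a group of *-automorphisms *)
Definition automorphism_group (G : groupType) (alpha : G -> A -> A) : Prop :=
  [/\ (forall g, star_automorphism (alpha g)), alpha 1%g = id,
      (forall g h, alpha (g * h)%g = alpha g \o alpha h)
    & injective alpha].

(* phi is G-strongly quasi-invariant, with cocycle x *)
Definition strongly_quasi_invariant (G : groupType) (alpha : G -> A -> A)
    (phi : {scalar A}) (x : G -> A) : Prop :=
  forall g, star (x g) = x g /\ forall a, phi (alpha g a) = phi (x g ** a).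

End CStarAlgebras.

Section Operators.
Context {R : realType} {H : hilbertType R}.

Definition bounded_operator (T : H -> H) : Prop :=
  linear T /\ exists k : R[i], forall xi, `|T xi| <= k * `|xi|.

Definition is_adjoint (T S : H -> H) : Prop :=
  forall xi eta, inner xi (T eta) = inner (S xi) eta.

Definition adjoint (T : H -> H) : H -> H :=
  xget (fun=> 0) [set S | is_adjoint T S].

Definition commutant (M : set (H -> H)) : set (H -> H) :=
  [set T | bounded_operator T /\ forall S, M S -> T \o S = S \o T].

Definition bicommutant (M : set (H -> H)) := commutant (commutant M).

Definition unitary (T : H -> H) : Prop :=
  [/\ linear T, (forall xi eta, inner (T xi) (T eta) = inner xi eta)
    & (forall eta, exists xi, T xi = eta)].

Definition unitary_representation (G : groupType) (U : G -> H -> H) : Prop :=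
  [/\ (forall g, unitary (U g)), U 1%g = id
    & forall g h, U (g * h)%g = U g \o U h].

Definition star_representation (A : cstarAlgType R) (pi : A -> H -> H) : Prop :=
  [/\ (forall a, bounded_operator (pi a)),
      linear pi, (forall a b, pi (a ** b) = pi a \o pi b)
    & (forall a, is_adjoint (pi a) (pi (star a)))].

Definition is_GNS (A : cstarAlgType R) (phi : {scalar A})
    (pi : A -> H -> H) (Phi : H) : Prop :=
  [/\ star_representation pi, dense (range (fun a => pi a Phi))
    & forall a, phi a = inner Phi (pi a Phi)].

Definition conj_by (U : H -> H) (T : H -> H) : H -> H := U \o T \o adjoint U.

End Operators.

Definition borel (G : ptopologicalType) := g_sigma_algebraType (@open G).
HB.instance Definition _ (G : ptopologicalType) := Measurable.on (borel G).

Section HaarIntegration.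
Context {R : realType} {G : topologicalGroupType}.
Implicit Types (K : set G) (mu : {measure set (borel G) -> \bar R}).

(* The restriction of mu to the compact subgroup K is the normalized Haar
   measure of K; nothing is assumed on mu outside K. *)
Definition normalized_haar K mu : Prop :=
  [/\ mu K = 1%E,
      (forall (g : G) (B : set (borel G)), K g -> measurable B -> B `<=` K ->
         mu [set (g * h)%g | h in B] = mu B)
    & (forall B : set (borel G), measurable B -> B `<=` K ->
         mu B = ereal_sup [set mu C | C in [set C : set G |
                                            compact C /\ C `<=` B]])].

Definition cintegrable mu K (f : G -> R[i]) : Prop :=
  mu.-integrable K (fun g : borel G => (complex.Re (f g))%:E) /\
  mu.-integrable K (fun g : borel G => (complex.Im (f g))%:E).

Definition cintegral mu K (f : G -> R[i]) : R[i] :=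
  (\int[mu]_(g in K) complex.Re (f g)) +i* (\int[mu]_(g in K) complex.Im (f g)).

Context {H : hilbertType R}.

Definition is_weak_integral mu K (F : G -> H) (v : H) : Prop :=
  forall xi, cintegrable mu K (fun g => inner xi (F g)) /\
             inner xi v = cintegral mu K (fun g => inner xi (F g)).

Definition vintegral mu K (F : G -> H) : H :=
  xget 0 [set v | is_weak_integral mu K F v].

(* integral of an operator-valued function, in the strong sense *)
Definition opintegral mu K (T : G -> H -> H) : H -> H :=
  fun xi => vintegral mu K (fun g => T g xi).

End HaarIntegration.

(* Main.v *)
Require Import Defs.
From mathcomp Require Import all_boot all_order all_algebra.
From mathcomp Require Import all_classical all_reals all_analysis.
From mathcomp Require Import measurable_realfun complex ring lra.
Import Order.TTheory GRing.Theory Num.Theory.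
Import numFieldNormedType.Exports.
Local Open Scope classical_set_scope.
Local Open Scope complex_scope.
Local Open Scope ring_scope.

Set Implicit Arguments.
Unset Strict Implicit.
Unset Printing Implicit Defensive.

(** Why the theorem holds. Write u_g for conjugation by U_g, and <.,.> for the
    inner product.

    Averages as weak integrals. For a bounded operator y the function
    g |-> <v, u_g(y) w> = <U_g^* v, y U_g^* w> is continuous on the compact group
    G_N, hence integrable, and Riesz representation ([riesz]) turns its integral
    into <v, E_N(y) w> for a bounded operator E_N(y) ([inner_expectation],
    [expectation_bounded]). Every identity between averages is thus an identity
    between scalar integrals.

    E_N preserves the von Neumann algebra. The formula for U_g gives
    U_g pi(a) = pi(g(a)) U_g ([covariance]); so u_g preserves pi(A)' and pi(A)'',
    and an operator T in pi(A)' commutes with E_N(y) because its adjoint can be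
    moved inside the weak integral ([expectation_commute]).

    E_N preserves psi_G. By left invariance of the Haar measure P_N is the
    orthogonal projection onto the vectors fixed by G_N ([rep_average_fixed],
    [inner_fixed_average]). These spaces decrease with N, so the P_N Phi converge
    ([decreasing_projections_cvg]) and the limit Phi_G is fixed by every U_g.
    Therefore g |-> <Phi_G, u_g(y) Phi_G> is constant, equal to
    <Phi_G, y Phi_G>, and integrates to that value ([inner_fixed_expectation]).

    Martingale property, for M <= N. With f(g) = <v, u_g(y) w>, the coefficient of
    E_M E_N y is the integral of f(hg) over h in G_M and g in G_N, which is that of
    f over G_N by left invariance ([expectation_small_large]). The coefficient of
    E_N E_M y is the integral of f(gh), where h has to be integrated last so that
    right invariance in g applies ([expectation_large_small]). This uses an
    exchange of integrals for continuous functions ([continuous_fubini]) and the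
    unimodularity of compact groups, itself a consequence of the same exchange
    ([haar_inv_invariant], [haar_right_invariant]). *)

(** * Complex numbers and Hilbert space geometry *)

Section ComplexNumbers.
Context {R : realType}.
Implicit Types (z w : R[i]) (r s : R).

Lemma complex_Re_im z : z = (complex.Re z) +i* (complex.Im z).
Proof. by case: z. Qed.

Lemma complexP z w :
  complex.Re z = complex.Re w -> complex.Im z = complex.Im w -> z = w.
Proof. by case: z => a b; case: w => c d /= -> ->. Qed.

Lemma Re_mulC z w : complex.Re (z * w) =
  complex.Re z * complex.Re w - complex.Im z * complex.Im w.
Proof. by case: z => a b; case: w. Qed.

Lemma Im_mulC z w : complex.Im (z * w) =
  complex.Re z * complex.Im w + complex.Im z * complex.Re w.
Proof. by case: z => a b; case: w. Qed.

Lemma Re_conj z : complex.Re z^* = complex.Re z. Proof. by case: z. Qed.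

Lemma Re_normE z : (complex.Re `|z|)%:C = `|z|.
Proof. by rewrite RRe_real// ger0_real. Qed.

Lemma Re_le_norm z : `|complex.Re z| <= complex.Re `|z|.
Proof. by rewrite -lecR Re_normE normc_ge_Re. Qed.

Lemma Im_le_norm z : `|complex.Im z| <= complex.Re `|z|.
Proof.
have -> : `|complex.Im z| = `|complex.Re (- 'i * z)|.
  by rewrite -complexiE Re_mulC /=; congr `|_|; ring.
by apply: le_trans (Re_le_norm _) _; rewrite normrM normrN normCi mul1r.
Qed.

Lemma norm_le_ReIm z :
  complex.Re `|z| <= `|complex.Re z| + `|complex.Im z|.
Proof.
rewrite normc_def /= -[leRHS]ger0_norm ?addr_ge0// -sqrtr_sqr ler_wsqrtr//.
rewrite sqrrD !real_normK ?num_real// -addrA lerD2l lerDr.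
by rewrite mulrn_wge0// mulr_ge0.
Qed.

End ComplexNumbers.

Section HilbertGeometry.
Context {R : realType} {H : hilbertType R}.
Implicit Types (u v w : H) (z : R[i]).

(** The norm of a normed module over R[i] is valued in R[i]; estimates are
    carried out in R, where the order is total. *)
Definition hnorm u : R := complex.Re `|u|.

Lemma hnormE u : `|u| = (hnorm u)%:C.
Proof. by rewrite /hnorm RRe_real// ger0_real. Qed.

Lemma hnorm_ge0 u : 0 <= hnorm u.
Proof. by rewrite -ler0c -hnormE. Qed.

Lemma hnorm_eq0 u : hnorm u = 0 -> u = 0.
Proof. by move=> u0; apply: normr0_eq0; rewrite hnormE u0. Qed.

Lemma hnormN u : hnorm (- u) = hnorm u.
Proof. by rewrite /hnorm normrN. Qed.

Lemma hnormB u v : hnorm (u - v) = hnorm (v - u).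
Proof. by rewrite -hnormN opprB. Qed.

Lemma ler_hnormD u v : hnorm (u + v) <= hnorm u + hnorm v.
Proof. by rewrite -lecR rmorphD /= -!hnormE ler_normD. Qed.

Lemma ler_hdist u v w : hnorm (u - w) <= hnorm (u - v) + hnorm (v - w).
Proof. by rewrite -[u - w](subrKA v) ler_hnormD. Qed.

Lemma innerDl u v w : inner (u + v) w = inner u w + inner v w.
Proof. by rewrite innerC innerDr rmorphD /= -!innerC. Qed.

Lemma innerZl z u v : inner (z *: u) v = z^* * inner u v.
Proof. by rewrite innerC innerZr rmorphM /= -innerC. Qed.

Lemma innerNr u v : inner u (- v) = - inner u v.
Proof. by rewrite -scaleN1r innerZr mulN1r. Qed.

Lemma innerNl u v : inner (- u) v = - inner u v.
Proof. by rewrite innerC innerNr rmorphN /= -innerC. Qed.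

Lemma innerBr u v w : inner u (v - w) = inner u v - inner u w.
Proof. by rewrite innerDr innerNr. Qed.

Lemma innerBl u v w : inner (u - v) w = inner u w - inner v w.
Proof. by rewrite innerDl innerNl. Qed.

Lemma inner0r u : inner u 0 = 0.
Proof. by rewrite -(scale0r (0 : H)) innerZr mul0r. Qed.

Lemma inner_hnorm u : inner u u = (hnorm u ^+ 2)%:C.
Proof. by rewrite inner_norm hnormE rmorphXn. Qed.

Lemma cauchy_schwarz u v : `|inner u v| <= `|u| * `|v|.
Proof.
have [->|v0] := eqVneq v 0; first by rewrite inner0r !normr0 mulr0.
have nv : `|v| ^+ 2 != 0 by rewrite expf_neq0 // normr_eq0.
have nvr : (`|v| ^+ 2)^* = `|v| ^+ 2 by rewrite geC0_conj// exprn_ge0.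
pose b := inner v u.
(* the squared distance from u to the line spanned by v *)
have : 0 <= inner (u - (b / `|v| ^+ 2) *: v) (u - (b / `|v| ^+ 2) *: v).
  by rewrite inner_norm exprn_ge0.
rewrite innerBr !innerBl !innerZr !innerZl !inner_norm (innerC v u) -/b.
rewrite rmorphM /= fmorphV /= nvr.
have -> : `|u| ^+ 2 - b^* / `|v| ^+ 2 * b -
   (b / `|v| ^+ 2 * b^* - b / `|v| ^+ 2 * (b^* / `|v| ^+ 2 * `|v| ^+ 2)) =
   `|u| ^+ 2 - `|b| ^+ 2 / `|v| ^+ 2 by
    rewrite normCK; move: (`|v| ^+ 2) (b^*) nv => n c n0; field.
rewrite subr_ge0 ler_pdivrMr ?exprn_gt0 ?normr_gt0// -exprMn.
rewrite ler_pXn2r ?nnegrE ?mulr_ge0 ?normr_ge0//.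
by rewrite norm_conjC.
Qed.

Lemma Re_inner_le u v : complex.Re `|inner u v| <= hnorm u * hnorm v.
Proof.
by rewrite -lecR Re_normE rmorphM /= -!hnormE cauchy_schwarz.
Qed.

Lemma inner_ext u v : (forall w, inner w u = inner w v) -> u = v.
Proof.
move=> uv; apply/subr0_eq/hnorm_eq0/eqP; rewrite -sqrf_eq0; apply/eqP.
have := inner_hnorm (u - v); rewrite {1}innerBr uv subrr => /(congr1 (@complex.Re _)).
by move=> /= <-.
Qed.

Lemma hnorm_sqrD u v :
  hnorm (u + v) ^+ 2 =
  hnorm u ^+ 2 + hnorm v ^+ 2 + 2 * complex.Re (inner u v).
Proof.
have := inner_hnorm (u + v).
rewrite innerDr !innerDl !inner_hnorm (innerC u v) => /(congr1 (@complex.Re _)).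
rewrite /= => <-; rewrite !raddfD /= Re_conj; ring.
Qed.

(** Completeness, with the Cauchy condition read in R. *)
Lemma hilbert_cauchy_cvg (u_ : nat -> H) :
  (forall e : R, 0 < e ->
     exists N, forall m n, (N <= m)%N -> (N <= n)%N -> hnorm (u_ m - u_ n) < e) ->
  cvg (u_ n @[n --> \oo]).
Proof.
move=> uc; apply/cauchy_cvgP/cauchy_exP => e e0.
have er : e = (complex.Re e)%:C by rewrite RRe_real// gtr0_real.
have [|N uN] := uc (complex.Re e); first by rewrite -ltcR -er.
exists (u_ N), N => // n /= Nn.
by rewrite /= -ball_normE /= hnormE er ltcR uN.
Qed.

Lemma hilbert_cvgP (u_ : nat -> H) l :
  u_ n @[n --> \oo] --> l <->
  forall e : R, 0 < e -> exists N, forall n, (N <= n)%N -> hnorm (l - u_ n) < e.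
Proof.
split.
  move=> /cvgrPdist_lt ul e e0.
  have [|N _ uN] := ul e%:C; first by rewrite ltcR.
  by exists N => n Nn; have := uN n Nn; rewrite /= hnormE ltcR.
move=> ul; apply/cvgrPdist_lt => e e0.
have er : e = (complex.Re e)%:C by rewrite RRe_real// gtr0_real.
have [|N uN] := ul (complex.Re e); first by rewrite -ltcR -er.
by exists N => // n /= Nn; rewrite hnormE er ltcR uN.
Qed.

End HilbertGeometry.

(** * Riesz representation, bounded operators and their adjoints *)

Section Riesz.
Context {R : realType} {H : hilbertType R}.

(** Riesz representation, by minimising the energy |v|^2 - 2 Re (f v). Along a
    minimising sequence the first variation of the energy tends to 0 uniformly
    on bounded sets; this makes the sequence Cauchy, and the vanishing of the
    first variation at its limit is the claim. *)
Lemma riesz (f : H -> R[i]) (k : R) :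
  (forall u v, f (u + v) = f u + f v) -> (forall z u, f (z *: u) = z * f u) ->
  (forall u, complex.Re `|f u| <= k * hnorm u) ->
  exists w, forall v, inner w v = f v.
Proof.
move=> fD fZ fk.
pose J (v : H) : R := hnorm v ^+ 2 - 2 * complex.Re (f v).
have Jlb v : - k ^+ 2 <= J v.
  have h1 := fk v.
  have h2 := le_trans (ler_norm _) (Re_le_norm (f v)).
  have := sqr_ge0 (hnorm v - k).
  by rewrite /J; nra.
have Jinf : has_inf (range J).
  by split; [exists (J 0), 0 | exists (- k ^+ 2) => _ [v _ <-]].
pose m := inf (range J).
have mJ v : m <= J v by apply: ge_inf; [case: Jinf | exists v].
have minimising n : {v | J v < m + (n.+1%:R^-1) ^+ 2}.
  apply: cid; have [|_ [v _ <-] Jv] :=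
    @inf_adherent _ (range J) ((n.+1%:R^-1) ^+ 2) _ Jinf.
    by rewrite exprn_gt0// invr_gt0.
  by exists v.
pose v_ n := sval (minimising n).
have first_variation n w : `|complex.Re (inner (v_ n) w - f w)| <= hnorm w / n.+1%:R.
  set b := complex.Re _.
  have n0 : 0 < n.+1%:R^-1 :> R by rewrite invr_gt0.
  have [w0|w0] := eqVneq (hnorm w) 0.
    rewrite w0 mul0r /b (hnorm_eq0 w0) inner0r -(scale0r (0 : H)) fZ mul0r subr0.
    by rewrite normr0.
  have wgt0 : 0 < hnorm w by rewrite lt_def w0 hnorm_ge0.
  (* the energy at the minimum of the parabola t |-> J (v_ n + t w) *)
  pose t : R := - b / hnorm w ^+ 2.
  have hw : hnorm (t%:C *: w) ^+ 2 = t ^+ 2 * hnorm w ^+ 2.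
    rewrite {1}/hnorm normrZ hnormE normc_def /= expr0n /= addr0 sqrtr_sqr.
    by rewrite mul0r subr0 exprMn real_normK ?num_real.
  have := mJ (v_ n + t%:C *: w); rewrite /J hnorm_sqrD fD fZ hw innerZr.
  have := svalP (minimising n); rewrite -/(v_ n) /J raddfD /= !Re_mulC /= !mul0r !subr0.
  have bE : b = complex.Re (inner (v_ n) w) - complex.Re (f w) by rewrite /b raddfB.
  move=> h1 h2.
  have h3 : b ^+ 2 <= hnorm w ^+ 2 * (n.+1%:R^-1) ^+ 2.
    have h4 : 0 <= t ^+ 2 * hnorm w ^+ 2 + 2 * t * b + (n.+1%:R^-1) ^+ 2.
      rewrite bE; clearbody t; move: h1 h2; clear.
      move: (n.+1%:R^-1 ^+ 2) (hnorm w ^+ 2) (hnorm (v_ n) ^+ 2) => d a c.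
      move: (complex.Re (f w)) (complex.Re (f (v_ n))) => r s.
      move: (complex.Re (inner (v_ n) w)) => q h1 h2; nra.
    have h5 : t ^+ 2 * hnorm w ^+ 2 + 2 * t * b = - (b ^+ 2 / hnorm w ^+ 2).
      by rewrite /t; field.
    by move: h4; rewrite h5 addrC subr_ge0 ler_pdivrMr ?exprn_gt0// mulrC.
  rewrite -(@ler_pXn2r _ 2)// ?nnegrE ?normr_ge0 ?mulr_ge0 ?(ltW wgt0) ?(ltW n0)//.
  by rewrite real_normK ?num_real// exprMn.
have v_close p q : hnorm (v_ p - v_ q) <= p.+1%:R^-1 + q.+1%:R^-1.
  set w := v_ p - v_ q.
  have [w0|w0] := eqVneq (hnorm w) 0; first by rewrite w0 addr_ge0// invr_ge0.
  have wgt0 : 0 < hnorm w by rewrite lt_def w0 hnorm_ge0.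
  rewrite -(ler_pM2l wgt0) -expr2.
  have := first_variation p w; have := first_variation q w.
  have : inner w w = (inner (v_ p) w - f w) - (inner (v_ q) w - f w).
    by rewrite {1}/w innerBl; ring.
  rewrite inner_hnorm => /(congr1 (@complex.Re _)); rewrite raddfB /= => ->.
  move=> hq hp; rewrite mulrDr; apply: le_trans (ler_norm _) _.
  by apply: le_trans (ler_normB _ _) _; exact: lerD.
have vcvg : cvg (v_ n @[n --> \oo]).
  apply: hilbert_cauchy_cvg => e e0.
  have [N _ Ne] := near_infty_natSinv_lt (PosNum (divr_gt0 e0 (ltr0n _ 2))).
  exists N => p q Np Nq; apply: le_lt_trans (v_close p q) _.
  by rewrite [ltRHS]splitr; apply: ltrD; exact: Ne.
exists (lim (v_ n @[n --> \oo])); move: vcvg => /cvgP; set l := lim _.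
move=> /hilbert_cvgP vl.
have Re0 w : complex.Re (inner l w) = complex.Re (f w).
  apply/eqP; rewrite -subr_eq0 -normr_le0; apply/ler_addgt0Pl => e e0.
  rewrite addr0.
  pose d := e / (2 * (hnorm w + 1)).
  have hw0 := hnorm_ge0 w.
  have d0 : 0 < d by rewrite divr_gt0// mulr_gt0// ltr_wpDl.
  have [N1 vN1] := vl d d0.
  have [N2 _ Ne] := near_infty_natSinv_lt (PosNum d0).
  pose n := maxn N1 N2.
  have h1 := vN1 n (leq_maxl _ _); have h2 := Ne n (leq_maxr _ _); rewrite /= in h2.
  have h3 := first_variation n w.
  have h4 := le_trans (Re_le_norm _) (Re_inner_le (l - v_ n) w).
  rewrite -raddfB /=.
  have -> : inner l w - f w = inner (l - v_ n) w + (inner (v_ n) w - f w).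
    by rewrite innerBl; ring.
  rewrite raddfD /=; apply: le_trans (ler_normD _ _) _.
  have de : d * (2 * (hnorm w + 1)) = e.
    by rewrite /d divfK// gt_eqF// mulr_gt0// ltr_wpDl.
  have h5 : hnorm (l - v_ n) * hnorm w <= d * hnorm w.
    by rewrite ler_wpM2r// ltW.
  have h6 : hnorm w / n.+1%:R <= hnorm w * d by rewrite ler_wpM2l// ltW.
  apply: le_trans (lerD (le_trans h4 h5) (le_trans h3 h6)) _.
  rewrite -[leRHS]de; have -> : d * (2 * (hnorm w + 1)) =
    d * hnorm w + hnorm w * d + d * 2 by ring.
  by rewrite lerDl mulr_ge0// ltW.
move=> w; apply: complexP => //.
have := Re0 ((- 'i) *: w); rewrite innerZr fZ -complexiE !Re_mulC /= !oppr0 !mul0r !add0r.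
by rewrite mulN1r opprK mulN1r opprK.
Qed.

Lemma adjoint_unique (T S : H -> H) : is_adjoint T S -> adjoint T = S.
Proof.
move=> TS; apply: xget_unique => // S' TS'; apply/funext => u.
apply: inner_ext => w; rewrite innerC [RHS]innerC; congr (_ ^*).
by rewrite -TS -TS'.
Qed.

Lemma bounded_operatorP (T : H -> H) : bounded_operator T ->
  exists2 k : R, 0 <= k & forall u, hnorm (T u) <= k * hnorm u.
Proof.
move=> [_ [k Tk]]; exists (complex.Re `|k|); first by rewrite -ler0c Re_normE.
move=> u; rewrite -lecR rmorphM /= Re_normE -!hnormE.
have := Tk u => /[dup] /(le_trans (normr_ge0 _)) k0 /le_trans; apply.
by rewrite -[leLHS]ger0_norm// normrM normr_id.
Qed.

Lemma linear_opD (T : H -> H) : linear T -> forall u v, T (u + v) = T u + T v.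
Proof. by move=> TL u v; have := TL 1 u v; rewrite !scale1r. Qed.

Lemma linear_opB (T : H -> H) : linear T -> forall u v, T (u - v) = T u - T v.
Proof.
by move=> TL u v; rewrite addrC -scaleN1r TL scaleN1r addrC.
Qed.

Lemma linear_opZ (T : H -> H) : linear T -> forall z u, T (z *: u) = z *: T u.
Proof.
move=> TL z u; have T0 : T 0 = 0 by have := linear_opB TL 0 0; rewrite !subrr.
by have := TL z u 0; rewrite T0 !addr0.
Qed.

Lemma bounded_has_adjoint (T : H -> H) :
  bounded_operator T -> exists S, is_adjoint T S.
Proof.
move=> bT; have [TL _] := bT; have [k k0 Tk] := bounded_operatorP bT.
have adj u : {w | forall v, inner w v = inner u (T v)}.
  apply: cid; apply: (@riesz _ (hnorm u * k)).
  - by move=> v w; rewrite linear_opD// innerDr.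
  - by move=> z v; rewrite linear_opZ// innerZr.
  - move=> v; apply: le_trans (Re_inner_le _ _) _.
    by rewrite -mulrA ler_wpM2l// hnorm_ge0.
by exists (fun u => sval (adj u)) => u v; rewrite (svalP (adj u)).
Qed.

Lemma bounded_operator_comp (S T : H -> H) :
  bounded_operator S -> bounded_operator T -> bounded_operator (S \o T).
Proof.
move=> bS bT; have [SL _] := bS; have [TL _] := bT.
have [k k0 Sk] := bounded_operatorP bS; have [l l0 Tl] := bounded_operatorP bT.
split; first by move=> z u v /=; rewrite TL SL.
exists (k * l)%:C => u; rewrite !hnormE -rmorphM lecR /= -mulrA.
by apply: le_trans (Sk _) _; rewrite ler_wpM2l.
Qed.

(** Bounded operators are continuous, so they are determined on a dense set. *)
Lemma eq_bounded_dense (S T : H -> H) (D : set H) :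
  bounded_operator S -> bounded_operator T -> dense D ->
  (forall u, D u -> S u = T u) -> S = T.
Proof.
move=> bS bT dD ST; have [SL _] := bS; have [TL _] := bT.
have [k k0 Sk] := bounded_operatorP bS; have [l l0 Tl] := bounded_operatorP bT.
apply/funext => u; apply/subr0_eq/hnorm_eq0/eqP.
rewrite eq_le hnorm_ge0 andbT; apply/ler_addgt0Pl => e e0; rewrite addr0.
have kl : 0 < k + l + 1 by rewrite ltr_wpDl// addr_ge0.
have d0 : 0 < (e / (k + l + 1))%:C by rewrite ltcR divr_gt0.
have [|v [uv Dv]] := dD (ball u (e / (k + l + 1))%:C) _ (ball_open _ _).
  by exists u; exact: ballxx.
move: uv; rewrite -ball_normE /= hnormE ltcR => uv.
have -> : S u - T u = S (u - v) - T (u - v).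
  by rewrite (linear_opB SL) (linear_opB TL) (ST _ Dv) opprB subrKA.
apply: le_trans (ler_hnormD _ _) _; rewrite hnormN.
apply: le_trans (lerD (Sk _) (Tl _)) _; rewrite -mulrDl.
apply: le_trans (_ : (k + l + 1) * hnorm (u - v) <= _).
  by rewrite ler_wpM2r ?hnorm_ge0// lerDl.
by rewrite mulrC -ler_pdivlMr// ltW.
Qed.

End Riesz.

(** * Integrals of continuous functions over compact sets *)

Section CompactInduction.
Context {T : topologicalType}.

(** A property of sets that is hereditary, stable under binary unions and true
    near each point of K holds of K: a compact set is covered by finitely many
    of the good neighbourhoods. *)
Lemma compact_induction (K : set T) (P : set T -> Prop) :
  compact K -> P set0 -> (forall A B, A `<=` B -> P B -> P A) ->
  (forall A B, P A -> P B -> P (A `|` B)) ->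
  (forall x, K x -> exists2 U, nbhs x U & P U) -> P K.
Proof.
move=> /compact_near_coveringP Kc P0 Psub PU Ploc.
pose F := [set V : set (set T) |
  exists2 A, P A & forall B, P B -> A `<=` B -> V B].
have FF : Filter F.
  split.
  - by exists set0.
  - move=> V W [A PA AV] [B PB BW]; exists (A `|` B); first exact: PU.
    move=> C PC; rewrite subUset => -[AC BC].
    by split; [exact: AV | exact: BW].
  - by move=> V W VW [A PA AV]; exists A => // B PB AB; apply: VW; exact: AV.
have [|A PA /(_ A PA)KA] := Kc (set T) F (fun A x => A x) FF.
  move=> x Kx; have [U xU PU'] := Ploc x Kx.
  exists (U, [set B | U `<=` B]) => /=.
    by split => //; exists U.
  by move=> [y B] /= [Uy]; exact.
by apply: Psub PA; exact: KA.
Qed.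

End CompactInduction.

Lemma within_continuous_comp (X Y Z : topologicalType) (A : set X) (B : set Y)
    (f : X -> Y) (g : Y -> Z) :
  continuous f -> (forall x, A x -> B (f x)) ->
  {within B, continuous g} -> {within A, continuous (g \o f)}.
Proof.
move=> fc AB /subspace_continuousP gc; apply/subspace_continuousP => x Ax.
have fAB : f @ within A (nbhs x) --> within B (nbhs (f x)).
  move=> V /= BV; have := fc x _ BV; rewrite /= !nbhs_simpl /=.
  by apply: filterS => y /= fyV Ay; apply: fyV; exact: AB.
exact: cvg_comp fAB (gc _ (AB _ Ax)).
Qed.

Section BorelIntegrals.
Context {R : realType} {G : topologicalGroupType}.
Implicit Types (K D : set G) (f : G -> R).
Implicit Types (mu : {measure set (borel G) -> \bar R}).

Lemma open_borel (U : set G) : open U -> measurable (U : set (borel G)).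
Proof. by move=> oU; apply: sub_sigma_algebra. Qed.

Lemma compact_borel K :
  hausdorff_space G -> compact K -> measurable (K : set (borel G)).
Proof.
move=> hG cK; rewrite -(setCK K); apply: measurableC; apply: open_borel.
by apply: closed_openC; exact: compact_closed.
Qed.

Lemma within_continuous_measurable K f : measurable (K : set (borel G)) ->
  {within K, continuous f} -> measurable_fun (K : set (borel G)) f.
Proof.
move=> mK /continuousP cf.
apply: (measurability _ (measurable_realfun.RGenOpens.measurableE R)).
move=> _ [_ [a [b ->] <-]].
have /cf /open_subspaceP [V oV VK] := @interval_open R (BRight a) (BLeft b) isT isT.
by rewrite setIC -VK; apply: measurableI => //; exact: open_borel.
Qed.

Lemma within_continuous_integrable K D mu f :
  compact K -> measurable (K : set (borel G)) -> mu K = 1%E ->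
  measurable (D : set (borel G)) -> D `<=` K ->
  {within K, continuous f} ->
  mu.-integrable (D : set (borel G)) (EFin \o f).
Proof.
move=> cK mK muK mD DK cf; apply: (integrableS mK) => //.
apply: measurable_bounded_integrable => //; first by rewrite muK ltry.
  exact: within_continuous_measurable.
have [M [Mr MP]] := compact_bounded (continuous_compact cf cK).
by exists M; split => // x Mx y Ky; apply: MP => //; exists y.
Qed.

Lemma integrable_const D mu (c : R) :
  measurable (D : set (borel G)) -> (mu D < +oo)%E ->
  mu.-integrable (D : set (borel G)) (EFin \o (fun=> c)).
Proof.
move=> mD muD; apply: measurable_bounded_integrable => //.
by exists `|c|; split; [exact: num_real | move=> M cM y _; exact: ltW].
Qed.

Lemma Rintegral_dist D mu f1 f2 (e : R) : measurable (D : set (borel G)) ->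
  mu.-integrable (D : set (borel G)) (EFin \o f1) ->
  mu.-integrable (D : set (borel G)) (EFin \o f2) ->
  (mu D < +oo)%E -> (forall x, D x -> `|f1 x - f2 x| <= e) ->
  `|\int[mu]_(x in D) f1 x - \int[mu]_(x in D) f2 x| <= e * fine (mu D).
Proof.
move=> mD if1 if2 muD f12; rewrite -RintegralB// -Rintegral_cst//.
have i12 : mu.-integrable (D : set (borel G)) (EFin \o (fun x => f1 x - f2 x)).
  by have := integrableB mD if1 if2; apply: eq_integrable.
apply: le_trans (le_normr_Rintegral mD i12) _; apply: le_Rintegral => //.
- exact: (integrable_norm i12).
- exact: integrable_const.
Qed.

End BorelIntegrals.

(** The tube lemma, in metric form. *)
Lemma tube_uniform {R : realType} {X Y : topologicalType} (L1 : set X)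
    (L2 : set Y) (F : X -> Y -> R) (e : R) h0 :
  compact L1 -> {within L1 `*` L2, continuous (fun p => F p.1 p.2)} ->
  0 < e -> L2 h0 ->
  \forall h \near h0, L2 h -> forall g, L1 g -> `|F g h - F g h0| < e.
Proof.
move=> cL1 /subspace_continuousP cF e0 L2h0.
have /near_covering_withinP := iffLR (compact_near_coveringP _) cL1.
move=> /(_ Y (nbhs h0) (fun h g => L2 h -> `|F g h - F g h0| < e) _) nc.
suff : \forall h \near h0, L1 `<=` (fun g => L2 h -> `|F g h - F g h0| < e).
  by apply: filterS => h hL L2h g /hL; exact.
apply: nc => g L1g.
have e2 : 0 < e / 2 by rewrite divr_gt0.
have /cvgrPdist_lt /(_ _ e2) [[U V] /= [Ug Vh] UV] := cF (g, h0) (conj L1g L2h0).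
exists (U, V) => // -[g' h] /= [Ug' Vh'] L1g' L2h.
have h1 := UV (g', h) (conj Ug' Vh') (conj L1g' L2h).
have h2 := UV (g', h0) (conj Ug' (nbhs_singleton Vh)) (conj L1g' L2h0).
have -> : F g' h - F g' h0 = (F g h0 - F g' h0) - (F g h0 - F g' h) by ring.
by apply: le_lt_trans (ler_normB _ _) _; rewrite [ltRHS]splitr ltrD.
Qed.

Section ContinuousFubini.
Context {R : realType} {G : topologicalGroupType}.
Implicit Types (K D : set G) (F : G -> G -> R).
Implicit Types (mu : {measure set (borel G) -> \bar R}).

Lemma within_continuous_section K1 K2 F h :
  {within K1 `*` K2, continuous (fun p => F p.1 p.2)} -> K2 h ->
  {within K1, continuous (F^~ h)}.
Proof.
move=> cF K2h.
apply: (@within_continuous_comp _ _ _ _ _ (fun g => (g, h)) _ _ _ cF) => //.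
by move=> g; apply: cvg_pair; [exact: cvg_id | exact: cvg_cst].
Qed.

Lemma within_continuous_swap K1 K2 F :
  {within K1 `*` K2, continuous (fun p => F p.1 p.2)} ->
  {within K2 `*` K1, continuous (fun p => F p.2 p.1)}.
Proof.
apply: (@within_continuous_comp _ _ _ _ _ (fun p => (p.2, p.1))).
  by move=> p; apply: cvg_pair; [exact: cvg_snd | exact: cvg_fst].
by move=> p [].
Qed.

Lemma fine_measure_le1 K D mu :
  measurable (K : set (borel G)) -> measurable (D : set (borel G)) ->
  mu K = 1%E -> D `<=` K -> (mu D < +oo)%E /\ fine (mu D) <= 1.
Proof.
move=> mK mD muK DK.
have muD : (mu D <= 1)%E by rewrite -muK le_measure ?inE.
split; first by apply: le_lt_trans muD _; rewrite ltry.
have : (mu D \is a fin_num) by rewrite ge0_fin_numE// (le_lt_trans muD) ?ltry.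
by move=> fD; rewrite -lee_fin fineK.
Qed.

Lemma within_continuous_Rintegral K1 K2 D mu F :
  compact K1 -> compact K2 -> measurable (K2 : set (borel G)) ->
  mu K2 = 1%E -> measurable (D : set (borel G)) -> D `<=` K2 ->
  {within K1 `*` K2, continuous (fun p => F p.1 p.2)} ->
  {within K1, continuous (fun g => \int[mu]_(h in D) F g h)}.
Proof.
move=> cK1 cK2 mK2 muK2 mD DK cF; apply/subspace_continuousP => g0 K1g0.
have [muD muD1] := fine_measure_le1 mK2 mD muK2 DK.
have cF' := within_continuous_swap cF.
have iF g : K1 g -> mu.-integrable (D : set (borel G)) (EFin \o F g).
  move=> K1g; apply: (@within_continuous_integrable _ _ K2) => //.
  exact: (within_continuous_section (F := fun h g => F g h)) cF' _.
apply/cvgrPdist_lt => e e0; have e2 : 0 < e / 2 by rewrite divr_gt0.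
have := tube_uniform (F := fun h g => F g h) cK2 cF' e2 K1g0.
apply: filterS => g gF K1g /=.
rewrite distrC; apply: le_lt_trans (_ : e / 2 < e); last first.
  by rewrite ltr_pdivrMr// ltr_pMr// ltr1n.
apply: le_trans (_ : e / 2 * fine (mu D) <= _); last first.
  by rewrite ger_pMr.
apply: Rintegral_dist => //; [exact: iF | exact: iF |].
by move=> h /DK K2h; apply/ltW/gF.
Qed.

(** Iterated integrals of a continuous function can be exchanged. Open subsets
    of G x G need not belong to the product of the Borel sigma-algebras unless G
    is second countable, so product measures are avoided. On a small piece of
    the second factor the integrand is uniformly close to a function of the first
    variable alone, for which both orders of integration agree; by compactness
    finitely many such pieces cover the second factor, and the errors add up to a
    multiple of the total mass. *)
Lemma continuous_fubini K1 K2 mu1 mu2 F :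
  compact K1 -> compact K2 ->
  measurable (K1 : set (borel G)) -> measurable (K2 : set (borel G)) ->
  mu1 K1 = 1%E -> mu2 K2 = 1%E ->
  {within K1 `*` K2, continuous (fun p => F p.1 p.2)} ->
  \int[mu1]_(g in K1) (\int[mu2]_(h in K2) F g h) =
  \int[mu2]_(h in K2) (\int[mu1]_(g in K1) F g h).
Proof.
move=> cK1 cK2 mK1 mK2 mu1K mu2K cF.
have cF' := within_continuous_swap cF.
pose I h := \int[mu1]_(g in K1) F g h.
pose S D g := \int[mu2]_(h in D) F g h.
have cI : {within K2, continuous I}.
  exact: (within_continuous_Rintegral (F := fun h g => F g h)) cF'.
have cS D : measurable (D : set (borel G)) -> D `<=` K2 ->
    {within K1, continuous (S D)}.
  by move=> mD DK; exact: (within_continuous_Rintegral (K2 := K2)).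
have iS D : measurable (D : set (borel G)) -> D `<=` K2 ->
    mu1.-integrable (K1 : set (borel G)) (EFin \o S D).
  by move=> mD DK; apply: (@within_continuous_integrable _ _ K1) => //; exact: cS.
have iI D : measurable (D : set (borel G)) -> D `<=` K2 ->
    mu2.-integrable (D : set (borel G)) (EFin \o I).
  by move=> mD DK; exact: (@within_continuous_integrable _ _ K2).
have iF1 h : K2 h -> mu1.-integrable (K1 : set (borel G)) (EFin \o F^~ h).
  move=> K2h; apply: (@within_continuous_integrable _ _ K1) => //.
  exact: within_continuous_section cF _.
have iF2 D g : measurable (D : set (borel G)) -> D `<=` K2 -> K1 g ->
    mu2.-integrable (D : set (borel G)) (EFin \o F g).
  move=> mD DK K1g; apply: (@within_continuous_integrable _ _ K2) => //.
  exact: (within_continuous_section (F := fun h g => F g h)) cF' _.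
have K1fin : (mu1 K1 < +oo)%E by rewrite mu1K ltry.
pose gap D := `|\int[mu1]_(g in K1) S D g - \int[mu2]_(h in D) I h|.
suff approx e : 0 < e -> gap K2 <= e * 2.
  apply/eqP; rewrite -subr_eq0 -normr_le0; apply/ler_addgt0Pl => e e0.
  rewrite addr0; have e2 : 0 < e / 2 by rewrite divr_gt0.
  by have := approx _ e2; rewrite divfK.
move=> e0.
(* a measurable envelope makes the property hereditary and lets a union be cut
   into disjoint measurable pieces *)
pose small (A : set G) := exists2 B : set (borel G), measurable B &
  A `<=` B /\ forall D : set (borel G), measurable D -> D `<=` B `&` K2 ->
     gap D <= e * 2 * fine (mu2 D).
suff [B mB [KB /(_ K2 mK2)]] : small K2.
  by rewrite mu2K /= mulr1; apply => x K2x; split => //; exact: KB.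
apply: compact_induction => //.
- exists set0 => //; split => // D mD; rewrite set0I subset0 => ->.
  rewrite /gap /S Rintegral_set0 (@eq_Rintegral _ _ _ _ _ (fun=> 0)); last first.
    by move=> g _; rewrite Rintegral_set0.
  by rewrite Rintegral_cst// mul0r subrr normr0 measure0 /= mulr0.
- by move=> A B AB [C mC [BC PC]]; exists C => //; split => //; exact: subset_trans BC.
- move=> A B [A' mA [AA' PA]] [B' mB [BB' PB]].
  exists (A' `|` B'); first exact: measurableU.
  split; first exact: setUSS.
  move=> D mD Dsub.
  have DK : D `<=` K2 by move=> x /Dsub[].
  pose D1 := D `&` A'; pose D2 := D `\` A'.
  have mD1 : measurable (D1 : set (borel G)) by exact: measurableI.
  have mD2 : measurable (D2 : set (borel G)) by exact: measurableD.
  have D1K : D1 `<=` K2 by move=> x [/DK].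
  have D2K : D2 `<=` K2 by move=> x [/DK].
  have DE : D = D1 `|` D2 by rewrite setUIDK.
  have D12 : [disjoint D1 & D2] by apply/disj_setPS => x [[_ +] [_]].
  have h1 : gap D1 <= e * 2 * fine (mu2 D1).
    by apply: PA => // x [Dx A'x]; split => //; exact: DK.
  have h2 : gap D2 <= e * 2 * fine (mu2 D2).
    by apply: PB => // x [/Dsub[[//|B'x] K2x]].
  have ID : \int[mu2]_(h in D) I h =
      \int[mu2]_(h in D1) I h + \int[mu2]_(h in D2) I h.
    by rewrite {1}DE Rintegral_setU// -DE; exact: iI.
  have SD : \int[mu1]_(g in K1) S D g =
      \int[mu1]_(g in K1) S D1 g + \int[mu1]_(g in K1) S D2 g.
    rewrite -RintegralD//; [|exact: iS|exact: iS].
    apply: eq_Rintegral => g; rewrite inE => K1g.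
    by rewrite {1}/S {1}DE Rintegral_setU// -DE; exact: iF2.
  have muD : fine (mu2 D) = fine (mu2 D1) + fine (mu2 D2).
    have [f1 _] := fine_measure_le1 mK2 mD1 mu2K D1K.
    have [f2 _] := fine_measure_le1 mK2 mD2 mu2K D2K.
    rewrite {1}DE measureU ?fineD ?ge0_fin_numE//.
    by apply/seteqP; split => x // [[_ +] [_]].
  rewrite /gap SD ID muD mulrDr opprD addrACA.
  by apply: le_trans (ler_normD _ _) _; exact: lerD.
move=> h0 K2h0.
have [U [oU Uh0] UF] : exists2 U, open_nbhs h0 U &
    forall h, U h -> K2 h -> forall g, K1 g -> `|F g h - F g h0| < e.
  have := tube_uniform cK1 cF e0 K2h0; rewrite /prop_near1 nbhsE.
  by case=> U oU UF; exists U.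
exists U; first exact: open_nbhs_nbhs.
exists (U : set (borel G)); first exact: open_borel.
split => // D mD DU.
have DK : D `<=` K2 by move=> x /DU[].
have [Dfin D1] := fine_measure_le1 mK2 mD mu2K DK.
have close g h : K1 g -> D h -> `|F g h - F g h0| <= e.
  by move=> K1g /DU[Uh K2h]; apply/ltW/UF.
(* both iterated integrals are compared with I h0 * mu2 D *)
have h1 : `|\int[mu2]_(h in D) I h - I h0 * fine (mu2 D)| <= e * fine (mu2 D).
  rewrite -Rintegral_cst//; apply: Rintegral_dist => //.
  - exact: iI.
  - exact: integrable_const.
  move=> h Dh; have -> : e = e * fine (mu1 K1) by rewrite mu1K mulr1.
  apply: Rintegral_dist => //; [exact/iF1/DK | exact: iF1 |].
  by move=> g K1g; exact: close.
have h2 : `|\int[mu1]_(g in K1) S D g - I h0 * fine (mu2 D)| <=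
    e * fine (mu2 D).
  rewrite -RintegralZr//; last exact: iF1.
  have -> : e * fine (mu2 D) = e * fine (mu2 D) * fine (mu1 K1).
    by rewrite mu1K mulr1.
  apply: Rintegral_dist => //; first exact: iS.
    by have := integrableZr mK1 (fine (mu2 D)) (iF1 h0 K2h0); apply: eq_integrable.
  move=> g K1g; rewrite -Rintegral_cst//; apply: Rintegral_dist => //.
  - exact: iF2.
  - exact: integrable_const.
  - by move=> h; exact: close.
have -> : e * 2 * fine (mu2 D) = e * fine (mu2 D) + e * fine (mu2 D) by ring.
rewrite /gap -[X in `|X|](subrKA (I h0 * fine (mu2 D))).
apply: le_trans (ler_normD _ _) _; apply: lerD => //.
by rewrite distrC.
Qed.

End ContinuousFubini.

(** * Invariance of the Haar measure of a compact group *)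

Section HaarInvariance.
Context {R : realType} {G : topologicalGroupType}.
Variables (K : set G) (mu : {measure set (borel G) -> \bar R}).
Hypotheses (hG : hausdorff_space G) (cK : compact K) (sK : subgroup K).
Hypothesis muK : normalized_haar K mu.
Implicit Types (f : G -> R).

Let mK : measurable (K : set (borel G)). Proof. exact: compact_borel. Qed.
Let muK1 : mu K = 1%E. Proof. by case: muK. Qed.

Lemma mulg_continuousl (g : G) : continuous (fun h : G => (g * h)%g).
Proof.
move=> h; apply: (@cvg_comp _ _ _ (fun h : G => (g, h))
  (fun p => (p.1 * p.2)%g) _ (nbhs (g, h)) _ _ (mulg_continuous (g, h))).
by apply: cvg_pair; [exact: cvg_cst | exact: cvg_id].
Qed.

Lemma mulg_continuousr (h : G) : continuous (fun g : G => (g * h)%g).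
Proof.
move=> g; apply: (@cvg_comp _ _ _ (fun g : G => (g, h))
  (fun p => (p.1 * p.2)%g) _ (nbhs (g, h)) _ _ (mulg_continuous (g, h))).
by apply: cvg_pair; [exact: cvg_id | exact: cvg_cst].
Qed.

Lemma mulVg_continuous : continuous (fun p : G * G => (p.1^-1 * p.2)%g).
Proof.
move=> p; apply: (@cvg_comp _ _ _ (fun p : G * G => (p.1^-1, p.2)%g)
  (fun p => (p.1 * p.2)%g) _ (nbhs (p.1^-1, p.2)%g) _ _
  (mulg_continuous (p.1^-1, p.2)%g)).
apply: cvg_pair; last exact: cvg_snd.
by apply: cvg_comp cvg_fst _; exact: invg_continuous.
Qed.

(** The image of mu under left translation agrees with mu on the Borel subsets of
    K only, which is enough for integrals over K. *)
Lemma haar_left_invariant f h : {within K, continuous f} -> K h ->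
  \int[mu]_(g in K) f (h * g)%g = \int[mu]_(g in K) f g.
Proof.
move=> cf Kh; have [K1 KM KV] := sK; have [_ muh _] := muK.
pose phi : borel G -> borel G := fun g : G => (h * g)%g.
have mphi : measurable_fun [set: borel G] phi.
  apply: (@measurability _ _ (borel G) (borel G) setT phi (@open G)) => // _ [U oU <-].
  rewrite setTI; apply: open_borel; move: U oU; apply/continuousP.
  exact: mulg_continuousl.
have phiK : phi @^-1` K = K.
  apply/seteqP; split => g /= Kg; last exact: KM.
  by rewrite -[g](mulKg h); apply: KM => //; exact: KV.
(* f is Borel on K alone, so it is cut off outside K *)
pose f' : borel G -> \bar R := (EFin \o f) \_ K.
have mf' : @measurable_fun _ _ (borel G) (\bar R) setT f'.
  apply/(measurable_restrictT _ mK)/measurable_EFinP.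
  exact: within_continuous_measurable.
have cfphi : {within K, continuous (f \o phi)}.
  apply: within_continuous_comp cf; first exact: mulg_continuousl.
  by move=> g; exact: KM.
have f'phi g : K g -> f' (phi g) = (f (h * g)%g)%:E.
  by move=> Kg; rewrite /f' patchE mem_set//; exact: KM.
have if' : mu.-integrable (phi @^-1` K) (f' \o phi).
  rewrite phiK;
  apply: eq_integrable (within_continuous_integrable cK mK muK1 mK _ cfphi) => //.
  by move=> g; rewrite inE => Kg /=; rewrite f'phi.
have := integral_pushforward mphi mf' if' mK.
rewrite phiK (eq_measure_integral mu); last first.
  move=> B mB BK; rewrite /pushforward.
  rewrite -[RHS](muh (h^-1)%g)//; last exact: KV.
  congr (mu _); apply/seteqP; split => g /=.
    by move=> Bg; exists (phi g) => //; rewrite /phi mulKg.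
  by move=> [g' Bg' <-]; rewrite /phi mulVKg.
move=> E; rewrite /Rintegral; congr fine.
rewrite (eq_integral (f' \o phi)); last first.
  by move=> g; rewrite inE => Kg; rewrite /= f'phi.
rewrite -E; apply: eq_integral => g gK.
by rewrite /f' patchE gK.
Qed.

(** Compact groups are unimodular: the integral of f (g^-1 h) over K x K is the
    integral of f when h is integrated first, and that of f (g^-1) when g is. *)
Lemma haar_inv_invariant f : {within K, continuous f} ->
  \int[mu]_(g in K) f (g^-1)%g = \int[mu]_(g in K) f g.
Proof.
move=> cf; have [K1 KM KV] := sK.
have cfV : {within K, continuous (fun g => f (g^-1)%g)}.
  apply: within_continuous_comp cf; first exact: invg_continuous.
  exact: KV.
have := @continuous_fubini _ _ K K mu mu (fun g h => f (g^-1 * h)%g)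
  cK cK mK mK muK1 muK1.
have cF : {within K `*` K, continuous (fun p => f (p.1^-1 * p.2)%g)}.
  apply: within_continuous_comp cf; first exact: mulVg_continuous.
  by move=> p [K1p K2p]; apply: KM => //; exact: KV.
move=> /(_ cF).
rewrite (@eq_Rintegral _ (borel G) _ _ K (fun=> \int[mu]_(g in K) f g)); last first.
  by move=> g; rewrite inE => Kg; apply: haar_left_invariant => //; exact: KV.
rewrite [in RHS](@eq_Rintegral _ (borel G) _ _ K
  (fun=> \int[mu]_(g in K) f (g^-1)%g)); last first.
  move=> h; rewrite inE => Kh.
  rewrite -(@haar_left_invariant (fun g => f (g^-1)%g) h^-1%g)//; last exact: KV.
  by apply: eq_Rintegral => g _; rewrite invgM invgK.
by rewrite !Rintegral_cst// muK1 /= !mulr1.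
Qed.

(** Inversion exchanges left and right translations. *)
Lemma haar_right_invariant f h : {within K, continuous f} -> K h ->
  \int[mu]_(g in K) f (g * h)%g = \int[mu]_(g in K) f g.
Proof.
move=> cf Kh; have [K1 KM KV] := sK.
have cfV : {within K, continuous (fun g => f (g^-1)%g)}.
  apply: within_continuous_comp cf; first exact: invg_continuous.
  exact: KV.
rewrite -[RHS]haar_inv_invariant//.
rewrite -(@haar_left_invariant (fun g => f (g^-1)%g) h^-1%g)//; last exact: KV.
rewrite -[LHS]haar_inv_invariant.
  by apply: eq_Rintegral => g _; rewrite invgM invgK.
apply: within_continuous_comp cf; first exact: mulg_continuousr.
by move=> g Kg; exact: KM.
Qed.

End HaarInvariance.

(** * Integrals of complex functions *)

Section ComplexIntegrals.
Context {R : realType} {G : topologicalGroupType}.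
Implicit Types (f : G -> R[i]) (K : set G).
Implicit Types (mu : {measure set (borel G) -> \bar R}).

(** Stated on the two parts because integrals of complex functions are defined
    part by part. *)
Definition ccontinuous (X : topologicalType) (A : set X) (f : X -> R[i]) :=
  {within A, continuous (fun x => complex.Re (f x))} /\
  {within A, continuous (fun x => complex.Im (f x))}.

Lemma ccontinuous_comp (X Y : topologicalType) (A : set X) (B : set Y)
    (f : X -> Y) (g : Y -> R[i]) :
  continuous f -> (forall x, A x -> B (f x)) ->
  ccontinuous B g -> ccontinuous A (g \o f).
Proof.
move=> cf AB [rg ig]; split.
  exact: within_continuous_comp cf AB rg.
exact: within_continuous_comp cf AB ig.
Qed.

Lemma continuous_cintegrable K mu f :
  compact K -> measurable (K : set (borel G)) -> mu K = 1%E ->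
  ccontinuous K f -> cintegrable mu K f.
Proof.
move=> cK mK muK [rf imf]; split.
  exact: (within_continuous_integrable cK mK muK mK _ rf).
exact: (within_continuous_integrable cK mK muK mK _ imf).
Qed.

Lemma eq_cintegral K mu f1 f2 : (forall g, K g -> f1 g = f2 g) ->
  cintegral mu K f1 = cintegral mu K f2.
Proof.
by move=> f12; congr Complex; apply: eq_Rintegral => g; rewrite inE => /f12 ->.
Qed.

Lemma cintegral_cst K mu (z : R[i]) :
  measurable (K : set (borel G)) -> mu K = 1%E ->
  cintegral mu K (fun=> z) = z.
Proof.
by move=> mK muK; rewrite /cintegral !Rintegral_cst// muK /= !mulr1 -complex_Re_im.
Qed.

Lemma cintegralD K mu f1 f2 : measurable (K : set (borel G)) ->
  cintegrable mu K f1 -> cintegrable mu K f2 ->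
  cintegral mu K (fun g => f1 g + f2 g) = cintegral mu K f1 + cintegral mu K f2.
Proof.
move=> mK [r1 i1] [r2 i2]; rewrite /cintegral; apply: complexP => /=.
  by rewrite -RintegralD//; apply: eq_Rintegral => g _; rewrite raddfD.
by rewrite -RintegralD//; apply: eq_Rintegral => g _; rewrite raddfD.
Qed.

Lemma cintegralZl K mu f (z : R[i]) : measurable (K : set (borel G)) ->
  cintegrable mu K f ->
  cintegral mu K (fun g => z * f g) = z * cintegral mu K f.
Proof.
move=> mK [rf imf]; rewrite /cintegral; apply: complexP.
  rewrite Re_mulC /= -!RintegralZl// -RintegralB//; first last.
  - by have := integrableZl mK (complex.Im z) imf; apply: eq_integrable.
  - by have := integrableZl mK (complex.Re z) rf; apply: eq_integrable.
  by apply: eq_Rintegral => g _; rewrite Re_mulC.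
rewrite Im_mulC /= -!RintegralZl// -RintegralD//; first last.
- by have := integrableZl mK (complex.Im z) rf; apply: eq_integrable.
- by have := integrableZl mK (complex.Re z) imf; apply: eq_integrable.
by apply: eq_Rintegral => g _; rewrite Im_mulC.
Qed.

(** The factor 2 comes from bounding the real and the imaginary parts separately;
    only the existence of a bound matters in what follows. *)
Lemma cintegral_bound K mu f (c : R) :
  measurable (K : set (borel G)) -> mu K = 1%E -> cintegrable mu K f ->
  (forall g, K g -> complex.Re `|f g| <= c) ->
  complex.Re `|cintegral mu K f| <= c * 2.
Proof.
move=> mK muK [rf imf] fc; apply: le_trans (norm_le_ReIm _) _ => /=.
have Kfin : (mu K < +oo)%E by rewrite muK ltry.
have bound h : mu.-integrable (K : set (borel G)) (EFin \o h) ->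
    (forall g, K g -> `|h g| <= c) -> `|\int[mu]_(g in K) h g| <= c.
  move=> ih hc.
  have := @Rintegral_dist _ _ K mu h (fun=> 0) c mK ih (integrable_const 0 mK Kfin) Kfin.
  rewrite muK /= mulr1 Rintegral_cst// mul0r subr0; apply => g Kg.
  by rewrite subr0; exact: hc.
rewrite mulr_natr mulr2n; apply: lerD; apply: bound => // g Kg.
  exact: le_trans (Re_le_norm _) (fc g Kg).
exact: le_trans (Im_le_norm _) (fc g Kg).
Qed.

Lemma cintegral_fubini K1 K2 mu1 mu2 (F : G -> G -> R[i]) :
  compact K1 -> compact K2 ->
  measurable (K1 : set (borel G)) -> measurable (K2 : set (borel G)) ->
  mu1 K1 = 1%E -> mu2 K2 = 1%E ->
  ccontinuous (K1 `*` K2) (fun p => F p.1 p.2) ->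
  cintegral mu1 K1 (fun g => cintegral mu2 K2 (fun h => F g h)) =
  cintegral mu2 K2 (fun h => cintegral mu1 K1 (fun g => F g h)).
Proof.
move=> cK1 cK2 mK1 mK2 mu1K mu2K [rF iF]; congr Complex.
  exact: (continuous_fubini (F := fun g h => complex.Re (F g h))
    cK1 cK2 mK1 mK2 mu1K mu2K rF).
exact: (continuous_fubini (F := fun g h => complex.Im (F g h))
  cK1 cK2 mK1 mK2 mu1K mu2K iF).
Qed.

Lemma cintegral_haar_left K mu f h : hausdorff_space G -> compact K ->
  subgroup K -> normalized_haar K mu -> ccontinuous K f -> K h ->
  cintegral mu K (fun g => f (h * g)%g) = cintegral mu K f.
Proof.
move=> hG cK sK muK [rf imf] Kh; congr Complex.
  exact: haar_left_invariant rf Kh.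
exact: haar_left_invariant imf Kh.
Qed.

Lemma cintegral_haar_right K mu f h : hausdorff_space G -> compact K ->
  subgroup K -> normalized_haar K mu -> ccontinuous K f -> K h ->
  cintegral mu K (fun g => f (g * h)%g) = cintegral mu K f.
Proof.
move=> hG cK sK muK [rf imf] Kh; congr Complex.
  exact: haar_right_invariant rf Kh.
exact: haar_right_invariant imf Kh.
Qed.

End ComplexIntegrals.

(** * Weak integrals of vectors and operators *)

Section WeakIntegrals.
Context {R : realType} {G : topologicalGroupType} {H : hilbertType R}.
Variables (K : set G) (mu : {measure set (borel G) -> \bar R}).
Hypotheses (cK : compact K) (mK : measurable (K : set (borel G))).
Hypothesis muK : mu K = 1%E.

(** The conjugate of xi |-> \int <xi, F g> dg is a bounded linear functional; the
    vector that represents it is the weak integral. *)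
Lemma weak_integral_exists (F : G -> H) (c : R) :
  (forall xi, ccontinuous K (fun g => inner xi (F g))) ->
  (forall g, K g -> hnorm (F g) <= c) ->
  exists v, is_weak_integral mu K F v.
Proof.
move=> cF Fc.
have iF xi : cintegrable mu K (fun g => inner xi (F g)).
  exact: continuous_cintegrable.
have [||xi|v vE] :=
  @riesz _ H (fun xi => (cintegral mu K (fun g => inner xi (F g)))^*) (c * 2).
- move=> u v; rewrite -rmorphD -cintegralD//=; congr (_ ^*).
  by apply: eq_cintegral => g _; rewrite innerDl.
- move=> z u; rewrite -[z in RHS]conjCK -rmorphM -cintegralZl//=; congr (_ ^*).
  by apply: eq_cintegral => g _; rewrite innerZl.
- rewrite norm_conjC mulrAC; apply: cintegral_bound => // g Kg.
  apply: le_trans (Re_inner_le _ _) _.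
  by rewrite mulrC ler_wpM2r ?hnorm_ge0//; exact: Fc.
by exists v => xi; split=> //; rewrite innerC vE conjCK.
Qed.

Lemma vintegralP (F : G -> H) (c : R) :
  (forall xi, ccontinuous K (fun g => inner xi (F g))) ->
  (forall g, K g -> hnorm (F g) <= c) ->
  is_weak_integral mu K F (vintegral mu K F).
Proof. by move=> cF Fc; apply: xgetPex; exact: weak_integral_exists cF Fc. Qed.

(** Hypotheses under which the weak integral over K of a field of operators is
    again a bounded operator. *)
Definition bounded_field (T : G -> H -> H) (k : R) :=
  [/\ (forall g, K g -> linear (T g)),
      (forall g xi, K g -> hnorm (T g xi) <= k * hnorm xi)
    & (forall xi eta, ccontinuous K (fun g => inner eta (T g xi)))].

Lemma inner_opintegral T k xi eta : bounded_field T k ->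
  inner eta (opintegral mu K T xi) = cintegral mu K (fun g => inner eta (T g xi)).
Proof.
move=> [TL Tk cT].
by have [] := @vintegralP (T^~ xi) (k * hnorm xi) (cT xi) (fun g => Tk g xi) eta.
Qed.

Lemma opintegral_bounded T k : bounded_field T k ->
  bounded_operator (opintegral mu K T).
Proof.
move=> bT; have [TL Tk cT] := bT.
have iT xi eta : cintegrable mu K (fun g => inner eta (T g xi)).
  exact: continuous_cintegrable.
split.
  move=> z u v; apply: inner_ext => w.
  rewrite innerDr innerZr !(inner_opintegral _ _ bT) -cintegralZl// -cintegralD//.
    apply: eq_cintegral => g Kg; rewrite linear_opD ?linear_opZ ?innerDr ?innerZr//.
    - exact: TL.
    - exact: TL.
  rewrite (_ : (fun g => _) = (fun g => inner (z^* *: w) (T g u))) //.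
  by apply/funext => g; rewrite innerZl conjCK.
exists (k * 2)%:C => xi; rewrite !hnormE -rmorphM lecR.
set v := opintegral mu K T xi.
(* the bound at a point of K shows that k * hnorm xi is nonnegative *)
have [v0|v0] := eqVneq (hnorm v) 0.
  rewrite v0; have [k0|k0] := leP 0 k; first by rewrite !mulr_ge0// hnorm_ge0.
  have K1 : K !=set0.
    apply/set0P/eqP => K0; move: muK; rewrite K0 measure0 => /eqP.
    by rewrite eq_sym onee_eq0.
  have [g Kg] := K1; have := le_trans (hnorm_ge0 _) (Tk g xi Kg).
  by move=> h; rewrite mulrAC mulr_ge0.
have vgt0 : 0 < hnorm v by rewrite lt_def v0 hnorm_ge0.
rewrite -(ler_pM2l vgt0) -expr2.
have -> : hnorm v ^+ 2 = complex.Re (inner v v) by rewrite inner_hnorm.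
rewrite {2}/v (inner_opintegral _ _ bT).
apply: le_trans (ler_norm _) _; apply: le_trans (Re_le_norm _) _.
have -> : hnorm v * (k * 2 * hnorm xi) = hnorm v * (k * hnorm xi) * 2 by ring.
apply: cintegral_bound => // g Kg; apply: le_trans (Re_inner_le _ _) _.
by rewrite ler_wpM2l ?hnorm_ge0//; exact: Tk.
Qed.

End WeakIntegrals.

Section Continuity.
Context {R : realType} {H : hilbertType R}.

Lemma within_continuousP (X : topologicalType) (A : set X) (a : X -> H) :
  {within A, continuous a} <->
  forall x, A x -> forall e : R, 0 < e ->
    \forall y \near within A (nbhs x), hnorm (a x - a y) < e.
Proof.
split=> [/subspace_continuousP ca x Ax e e0|ca].
  have e0' : 0 < e%:C by rewrite ltcR.
  have /cvgrPdist_lt /(_ _ e0') := ca x Ax; apply: filterS => y.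
  by rewrite hnormE ltcR.
apply/subspace_continuousP => x Ax; apply/cvgrPdist_lt => e e0.
have er : e = (complex.Re e)%:C by rewrite RRe_real// gtr0_real.
have e0' : 0 < complex.Re e by rewrite -ltcR -er.
by apply: filterS (ca x Ax _ e0') => y; rewrite hnormE er ltcR.
Qed.

Lemma bounded_operator_continuous (X : topologicalType) (A : set X)
    (a : X -> H) (T : H -> H) : bounded_operator T ->
  {within A, continuous a} -> {within A, continuous (T \o a)}.
Proof.
move=> bT /within_continuousP ca; have [TL _] := bT.
have [k k0 Tk] := bounded_operatorP bT.
apply/within_continuousP => x Ax e e0.
have k1 : 0 < k + 1 by rewrite ltr_wpDl.
have e1 : 0 < e / (k + 1) by rewrite divr_gt0.
apply: filterS (ca x Ax _ e1) => y /=; rewrite -linear_opB// => axy.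
apply: le_lt_trans (Tk _) _; apply: le_lt_trans (_ : (k + 1) * hnorm (a x - a y) < e).
  by rewrite ler_wpM2r ?hnorm_ge0// lerDl.
by rewrite mulrC -ltr_pdivlMr.
Qed.

Lemma inner_ccontinuous (X : topologicalType) (A : set X) (a b : X -> H) :
  {within A, continuous a} -> {within A, continuous b} ->
  ccontinuous A (fun x => inner (a x) (b x)).
Proof.
move=> /within_continuousP ca /within_continuousP cb.
have near_inner x : A x -> forall e : R, 0 < e ->
    \forall y \near within A (nbhs x),
      complex.Re `|inner (a x) (b x) - inner (a y) (b y)| < e.
  move=> Ax e e0.
  pose S := hnorm (a x) + hnorm (b x) + 1.
  have S0 : 0 < S by rewrite ltr_wpDl// addr_ge0// hnorm_ge0.
  pose d := Num.min 1 (e / (2 * S)).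
  have d0 : 0 < d by rewrite lt_min ltr01 divr_gt0// mulr_gt0.
  apply: filterS2 (ca x Ax d d0) (cb x Ax d d0) => y ay by'.
  have -> : inner (a x) (b x) - inner (a y) (b y) =
      inner (a x) (b x - b y) + inner (a x - a y) (b y).
    by rewrite innerBr innerBl; ring.
  have bd : hnorm (b y) <= hnorm (b x) + 1.
    rewrite -[b y](subrK (b x)) addrC; apply: le_trans (ler_hnormD _ _) _.
    rewrite lerD2l hnormB; apply/ltW; apply: lt_le_trans by' _.
    by rewrite ge_min lexx.
  have dS : d * S <= e / 2.
    rewrite -ler_pdivlMr// -mulrA -invfM ge_min; apply/orP; right.
    by [].
  apply: le_lt_trans (_ : d * S < e); last first.
    by apply: le_lt_trans dS _; rewrite ltr_pdivrMr// ltr_pMr// ltr1n.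
  rewrite -lecR Re_normE; apply: le_trans (ler_normD _ _) _.
  rewrite -[X in X + _]Re_normE -[X in _ + X]Re_normE -rmorphD lecR.
  apply: le_trans (lerD (Re_inner_le _ _) (Re_inner_le _ _)) _.
  have -> : d * S = hnorm (a x) * d + d * (hnorm (b x) + 1) by rewrite /S; ring.
  apply: lerD; first by rewrite ler_wpM2l ?hnorm_ge0// ltW.
  by apply: ler_pM; rewrite ?hnorm_ge0// ltW.
split; apply/subspace_continuousP => x Ax; apply/cvgrPdist_lt => e e0;
  apply: filterS (near_inner x Ax e e0) => y; rewrite -raddfB; apply: le_lt_trans.
- exact: Re_le_norm.
- exact: Im_le_norm.
Qed.

End Continuity.

(** * Averages over compact subgroups of a unitary representation *)

Section UnitaryRepresentations.
Context {R : realType} {G : topologicalGroupType} {H : hilbertType R}.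
Variable U : G -> H -> H.
Hypothesis Urep : unitary_representation U.

Lemma rep_linear g : linear (U g).
Proof. by have [/(_ g)[]] := Urep. Qed.

Lemma rep_inner g u v : inner (U g u) (U g v) = inner u v.
Proof. by have [/(_ g)[]] := Urep. Qed.

Lemma repM g h u : U (g * h)%g u = U g (U h u).
Proof. by have [_ _ ->] := Urep. Qed.

Lemma repVK g u : U g (U (g^-1)%g u) = u.
Proof. by rewrite -repM mulgV; have [_ -> _] := Urep. Qed.

Lemma rep_adjointE g u v : inner u (U g v) = inner (U (g^-1)%g u) v.
Proof. by rewrite -[RHS](rep_inner g) repVK. Qed.

Lemma rep_hnorm g u : hnorm (U g u) = hnorm u.
Proof.
apply/eqP; rewrite -(@eqrXn2 _ 2) ?hnorm_ge0//; apply/eqP/complexI.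
by rewrite -!inner_hnorm rep_inner.
Qed.

Lemma rep_bounded g : bounded_operator (U g).
Proof.
split; first exact: rep_linear.
by exists 1 => u; rewrite mul1r !hnormE rep_hnorm.
Qed.

Lemma conj_byE g (y : H -> H) u : conj_by (U g) y u = U g (y (U (g^-1)%g u)).
Proof.
rewrite /conj_by /= (@adjoint_unique _ _ _ (U (g^-1)%g))// => v w.
exact: rep_adjointE.
Qed.

Lemma conj_by_mul g h (y : H -> H) :
  conj_by (U (g * h)%g) y = conj_by (U g) (conj_by (U h) y).
Proof. by apply/funext => u; rewrite !conj_byE invgM !repM. Qed.

Lemma conj_by_bounded g (y : H -> H) :
  bounded_operator y -> bounded_operator (conj_by (U g) y).
Proof.
move=> yb; rewrite (_ : conj_by _ _ = U g \o (y \o U (g^-1)%g)); last first.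
  by apply/funext => u; rewrite conj_byE.
apply: bounded_operator_comp; first exact: rep_bounded.
by apply: bounded_operator_comp => //; exact: rep_bounded.
Qed.

Section OnCompactSubgroup.
Variables (K : set G) (mu : {measure set (borel G) -> \bar R}).
Hypotheses (hG : hausdorff_space G) (cK : compact K) (sK : subgroup K).
Hypothesis muK : normalized_haar K mu.
Hypothesis Ucont : forall xi, {within K, continuous (fun g => U g xi)}.

Let mK : measurable (K : set (borel G)). Proof. exact: compact_borel. Qed.
Let muK1 : mu K = 1%E. Proof. by case: muK. Qed.

Lemma rep_inv_continuous u : {within K, continuous (fun g => U (g^-1)%g u)}.
Proof.
apply: (@within_continuous_comp _ _ _ K K (fun g => g^-1)%g (U^~ u)) => //.
  exact: invg_continuous.
by case: sK.
Qed.

Lemma rep_field : bounded_field K U 1.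
Proof.
split=> [g _|g u _|u v]; first exact: rep_linear.
  by rewrite rep_hnorm mul1r.
apply: (@inner_ccontinuous _ _ _ _ (fun=> v) (U^~ u)) => //.
by apply/subspace_continuousP => g _; exact: cvg_cst.
Qed.

Lemma conj_ccontinuous (y : H -> H) u v : bounded_operator y ->
  ccontinuous K (fun g => inner v (conj_by (U g) y u)).
Proof.
move=> yb.
rewrite (_ : (fun g => _) =
    fun g => inner (U (g^-1)%g v) ((y \o (fun g => U (g^-1)%g u)) g)).
  apply: (@inner_ccontinuous _ _ _ _ (fun g => U (g^-1)%g v)).
    exact: rep_inv_continuous.
  exact: (bounded_operator_continuous yb (@rep_inv_continuous u)).
by apply/funext => g; rewrite conj_byE rep_adjointE.
Qed.

Lemma conj_field (y : H -> H) : bounded_operator y ->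
  exists k, bounded_field K (fun g => conj_by (U g) y) k.
Proof.
move=> yb; have [k k0 yk] := bounded_operatorP yb.
exists k; split=> [g _|g u _|u v].
- by case: (conj_by_bounded g yb).
- by rewrite conj_byE rep_hnorm; apply: le_trans (yk _) _; rewrite rep_hnorm.
- exact: conj_ccontinuous.
Qed.

Definition expectation (y : H -> H) : H -> H :=
  opintegral mu K (fun g => conj_by (U g) y).

Lemma inner_expectation (y : H -> H) u v : bounded_operator y ->
  inner v (expectation y u) =
  cintegral mu K (fun g => inner v (conj_by (U g) y u)).
Proof. by move=> /conj_field[k]; exact: inner_opintegral. Qed.

Lemma expectation_bounded (y : H -> H) :
  bounded_operator y -> bounded_operator (expectation y).
Proof. by move=> /conj_field[k]; exact: opintegral_bounded. Qed.

(** Operators commuting with every conjugate of y commute with its average: the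
    adjoint of such an operator can be moved inside the weak integral. *)
Lemma expectation_commute (y T : H -> H) :
  bounded_operator y -> bounded_operator T ->
  (forall g, T \o conj_by (U g) y = conj_by (U g) y \o T) ->
  T \o expectation y = expectation y \o T.
Proof.
move=> yb bT Ty; have [S TS] := bounded_has_adjoint bT.
apply/funext => u; apply: inner_ext => v /=.
rewrite TS !inner_expectation//; apply: eq_cintegral => g _.
by rewrite -TS; have /(congr1 (fun f => f u)) /= -> := Ty g.
Qed.

Lemma inner_rep_average u v :
  inner v (opintegral mu K U u) = cintegral mu K (fun g => inner v (U g u)).
Proof. exact: inner_opintegral rep_field. Qed.

Lemma rep_average_fixed u h : K h ->
  U h (opintegral mu K U u) = opintegral mu K U u.
Proof.
move=> Kh; apply: inner_ext => v; rewrite rep_adjointE !inner_rep_average.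
have [_ _ cU] := rep_field.
rewrite -(cintegral_haar_left hG cK sK muK (cU u v) Kh).
by apply: eq_cintegral => g _; rewrite [in RHS]repM [in RHS]rep_adjointE.
Qed.

(** Together with [rep_average_fixed], this says that averaging over K is the
    orthogonal projection onto the vectors fixed by K. *)
Lemma inner_fixed_average u v : (forall g, K g -> U g v = v) ->
  inner v (opintegral mu K U u) = inner v u.
Proof.
move=> Kv; rewrite inner_rep_average -[RHS](cintegral_cst _ mK muK1).
apply: eq_cintegral => g Kg; rewrite rep_adjointE Kv//.
by case: sK => _ _; exact.
Qed.

Lemma inner_fixed_expectation (y : H -> H) u v : bounded_operator y ->
  (forall g, K g -> U g u = u) -> (forall g, K g -> U g v = v) ->
  inner v (expectation y u) = inner v (y u).
Proof.
move=> yb Ku Kv; rewrite inner_expectation// -[RHS](cintegral_cst _ mK muK1).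
have KV g : K g -> K (g^-1)%g by case: sK => _ _; exact.
apply: eq_cintegral => g Kg.
by rewrite conj_byE rep_adjointE Ku ?Kv//; exact: KV.
Qed.

End OnCompactSubgroup.

(** * The martingale property *)

Section Martingale.
Variables (K L : set G) (mu nu : {measure set (borel G) -> \bar R}).
Hypotheses (hG : hausdorff_space G) (KL : K `<=` L).
Hypotheses (cK : compact K) (sK : subgroup K) (muK : normalized_haar K mu).
Hypotheses (cL : compact L) (sL : subgroup L) (nuL : normalized_haar L nu).
Hypothesis Ucont : forall xi, {within L, continuous (fun g => U g xi)}.

Let mK : measurable (K : set (borel G)). Proof. exact: compact_borel. Qed.
Let muK1 : mu K = 1%E. Proof. by case: muK. Qed.
Let mL : measurable (L : set (borel G)). Proof. exact: compact_borel. Qed.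
Let nuL1 : nu L = 1%E. Proof. by case: nuL. Qed.
Let UcontK xi : {within K, continuous (fun g => U g xi)}.
Proof. exact: (continuous_subspaceW KL (@Ucont xi)). Qed.

(** E_L y is fixed by every u_h with h in L, by left invariance of the Haar
    measure of L; averaging it over K changes nothing. *)
Lemma expectation_small_large (y : H -> H) : bounded_operator y ->
  expectation K mu (expectation L nu y) = expectation L nu y.
Proof.
move=> yb; apply/funext => u; apply: inner_ext => v.
have bE : bounded_operator (expectation L nu y) by exact: expectation_bounded.
rewrite inner_expectation// -[RHS](cintegral_cst _ mK muK1).
apply: eq_cintegral => h Kh; rewrite conj_byE rep_adjointE !inner_expectation//.
rewrite -[RHS](@cintegral_haar_left _ _ L nu _ h)//; [|exact: conj_ccontinuous|exact: KL].
by apply: eq_cintegral => g _; rewrite conj_by_mul [in RHS]conj_byE rep_adjointE.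
Qed.

(** A matrix coefficient of E_L (E_K y) is a double integral of f (g h)
    over L x K. Once the integrals are exchanged, the inner one loses its
    dependence on h by right invariance of the Haar measure of L. *)
Lemma expectation_large_small (y : H -> H) : bounded_operator y ->
  expectation L nu (expectation K mu y) = expectation L nu y.
Proof.
move=> yb; apply/funext => u; apply: inner_ext => v.
have bE : bounded_operator (expectation K mu y) by exact: expectation_bounded.
have cf : ccontinuous L (fun g => inner v (conj_by (U g) y u)).
  exact: conj_ccontinuous.
rewrite !inner_expectation//.
transitivity (cintegral nu L (fun g => cintegral mu K (fun h =>
    inner v (conj_by (U (g * h)%g) y u)))).
  apply: eq_cintegral => g _; rewrite conj_byE rep_adjointE inner_expectation//.
  by apply: eq_cintegral => h _; rewrite conj_by_mul [in RHS]conj_byE rep_adjointE.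
rewrite cintegral_fubini//; last first.
  apply: ccontinuous_comp cf; first exact: mulg_continuous.
  by move=> [g h] /= [Lg /KL Lh]; case: sL => _ + _; apply.
rewrite -[RHS](cintegral_cst _ mK muK1); apply: eq_cintegral => h Kh.
exact: cintegral_haar_right (KL Kh).
Qed.

End Martingale.

End UnitaryRepresentations.

(** * Strong convergence of decreasing projections *)

Section DecreasingProjections.
Context {R : realType} {H : hilbertType R}.

(** The hypothesis holds for the images of one vector under a decreasing
    sequence of orthogonal projections; by Pythagoras the squared distance
    between two terms is the difference of their squared norms. *)
Lemma decreasing_projections_cvg (p_ : nat -> H) :
  (forall m n, (m <= n)%N -> inner (p_ n) (p_ m) = inner (p_ n) (p_ n)) ->
  cvg (p_ n @[n --> \oo]).
Proof.
move=> p_dec; pose a n := hnorm (p_ n) ^+ 2.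
have pyth m n : (m <= n)%N -> hnorm (p_ m - p_ n) ^+ 2 = a m - a n.
  move=> mn; have := hnorm_sqrD (p_ n) (p_ m - p_ n).
  rewrite innerBr p_dec// subrr /= mulr0 addr0 [p_ n + _]addrC subrK /a => ->.
  by ring.
have Jinf : has_inf (range a).
  by split; [exists (a 0), 0%N | exists 0 => _ [n _ <-]; exact: sqr_ge0].
apply: hilbert_cauchy_cvg => e e0.
have [|_ [N _ <-] aN] := @inf_adherent _ (range a) (e ^+ 2) _ Jinf.
  by rewrite exprn_gt0.
have close m n : (N <= m)%N -> (m <= n)%N -> hnorm (p_ m - p_ n) < e.
  move=> Nm mn; rewrite -(@ltr_pXn2r _ 2) ?nnegrE ?hnorm_ge0 ?(ltW e0)//.
  have an : inf (range a) <= a n by apply: ge_inf; [case: Jinf | exists n].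
  have aNm := sqr_ge0 (hnorm (p_ N - p_ m)); rewrite pyth// in aNm.
  by rewrite pyth//; lra.
exists N => m n Nm Nn; have [mn|/ltnW nm] := leqP m n; first exact: close.
by rewrite hnormB; exact: close.
Qed.

End DecreasingProjections.

(** * Covariance of the GNS representation *)

Section Covariance.
Context {R : realType} {G : topologicalGroupType} {H : hilbertType R}.
Context {A : cstarAlgType R}.
Variables (alpha : G -> A -> A) (x : G -> A) (phi : {scalar A}).
Variables (pi : A -> H -> H) (Phi : H) (U : G -> H -> H).
Hypothesis Gaut : automorphism_group alpha.
Hypothesis GNS : is_GNS phi pi Phi.
Hypothesis Urep : unitary_representation U.
Hypothesis Udef : forall g a,
  U g (pi a Phi) = pi (alpha g a ** csqrt (x (g^-1)%g)) Phi.

(** U_g implements the automorphism g. On the dense set of vectors pi b Phi this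
    is multiplicativity of g, because the factor csqrt (x g^-1) sits to the right
    of g b. *)
Lemma covariance g a : U g \o pi a = pi (alpha g a) \o U g.
Proof.
have [[pib pilin piM _] dPhi _] := GNS.
have [/(_ g)[_ _ alphaM _] _ _ _] := Gaut.
apply: eq_bounded_dense dPhi _.
- by apply: bounded_operator_comp => //; exact: rep_bounded.
- by apply: bounded_operator_comp => //; exact: rep_bounded.
move=> _ [b _ <-] /=.
by have := piM a b => /(congr1 (fun f => f Phi)) /= <-; rewrite !Udef alphaM -amulA piM.
Qed.

(** Conjugation by U_g permutes the pi a, so it preserves their commutant, and
    then also their bicommutant. *)
Lemma conj_by_commutant g T :
  commutant (range pi) T -> commutant (range pi) (conj_by (U g) T).
Proof.
move=> [bT TC]; split; first exact: conj_by_bounded.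
move=> _ [a _ <-]; apply/funext => u /=; rewrite !conj_byE//.
have alphaK : alpha g (alpha (g^-1)%g a) = a.
  have [_ alpha1 alphaM _] := Gaut.
  have /(congr1 (fun f => f a)) /= <- := alphaM g (g^-1)%g.
  by rewrite mulgV alpha1.
have cov h b v : U h (pi b v) = pi (alpha h b) (U h v).
  by have /(congr1 (fun f => f v)) := covariance h b.
rewrite cov -[in RHS]alphaK -[RHS]cov; congr (U g _).
by have /(congr1 (fun f => f (U (g^-1)%g u))) /= := TC _ (imageT pi (alpha (g^-1)%g a)).
Qed.

Lemma conj_by_bicommutant g y T : bicommutant (range pi) y ->
  commutant (range pi) T -> T \o conj_by (U g) y = conj_by (U g) y \o T.
Proof.
move=> [_ yC] TC; apply/funext => u /=; rewrite !conj_byE//.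
have /yC yT := conj_by_commutant (g^-1)%g TC.
have := yT => /(congr1 (fun f => f (U (g^-1)%g u))) /=; rewrite !conj_byE// invgK.
rewrite !(repVK Urep) => ->.
by rewrite (repVK Urep).
Qed.

End Covariance.

(** * The theorem *)

Theorem theorem4p1 (R : realType) (A : cstarAlgType R)
    (G : topologicalGroupType) (alpha : G -> A -> A) (GN : nat -> set G)
    (mu : nat -> {measure set (borel G) -> \bar R})
    (phi : {scalar A}) (x : G -> A)
    (H : hilbertType R) (pi : A -> H -> H) (Phi : H) (U : G -> H -> H)
    (Gaut : automorphism_group alpha)
    (Ghaus : hausdorff_space G)
    (Glc : locally_compact [set: G])
    (Gsep : separable G)
    (GNsub : forall N, subgroup (GN N))
    (GNcompact : forall N, compact (GN N))
    (GNincr : {homo GN : M N / (M <= N)%N >-> M `<=` N})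
    (GNcover : \bigcup_N GN N = [set: G])
    (muhaar : forall N, normalized_haar (GN N) (mu N))
    (phistate : is_state phi)
    (phifaithful : faithful phi)
    (phiqi : strongly_quasi_invariant alpha phi x)
    (phiGNS : is_GNS phi pi Phi)
    (Urep : unitary_representation U)
    (Udef : forall g a,
        U g (pi a Phi) = pi (alpha g a ** csqrt (x (g^-1)%g)) Phi)
    (xcont : forall N, {within GN N, continuous x})
    (Ucont : forall N xi, {within GN N, continuous (fun g => U g xi)}) :
  let fA := bicommutant (range pi) in
  let P N := opintegral (mu N) (GN N) U in
  let PG xi := lim (P N xi @[N --> \oo]) in
  let PhiG := PG Phi in
  let psiG (y : H -> H) := `|PhiG| ^- 2 * inner PhiG (y PhiG) in
  let E N (y : H -> H) :=
    opintegral (mu N) (GN N) (fun g => conj_by (U g) y) in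
  PhiG != 0 ->
  [/\ (forall N y, fA y -> fA (E N y)),
      (forall N y, fA y -> psiG (E N y) = psiG y)
    & (forall M N, (M <= N)%N -> forall y, fA y ->
         E N (E M y) = E M (E N y) /\ E M (E N y) = E N y)].
Proof.
move=> fA P PG PhiG psiG E _.
have fA_bounded y : fA y -> bounded_operator y by case.
have P_fixed N u g : GN N g -> U g (P N u) = P N u.
  exact: rep_average_fixed.
have P_cvg : cvg (P N Phi @[N --> \oo]).
  apply: decreasing_projections_cvg => M N MN.
  rewrite !inner_fixed_average// => g.
  - exact: P_fixed.
  - by move=> /(GNincr _ _ MN); exact: P_fixed.
(* from index N on the approximations P M Phi are fixed by U g *)
have PhiG_fixed N g : GN N g -> U g PhiG = PhiG.
  move=> GNg; apply/subr0_eq/hnorm_eq0/eqP.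
  rewrite eq_le hnorm_ge0 andbT; apply/ler_addgt0Pl => e e0; rewrite addr0.
  have [|M PM] := (hilbert_cvgP _ _).1 P_cvg (e / 2); first by rewrite divr_gt0.
  have PhiM := PM (maxn M N) (leq_maxl M N).
  have Pg : U g (P (maxn M N) Phi) = P (maxn M N) Phi.
    by apply: P_fixed; exact: GNincr (leq_maxr M N) _ GNg.
  apply: le_trans (ler_hdist _ (P (maxn M N) Phi) _) _.
  rewrite -{1}Pg -(linear_opB (rep_linear Urep g)) rep_hnorm//.
  by rewrite [hnorm (_ - PhiG)]hnormB (splitr e) lerD// ltW.
split=> [N y fAy|N y fAy|M N MN y fAy].
- split; first exact: expectation_bounded (fA_bounded _ fAy).
  move=> T TC; apply/esym; apply: expectation_commute => //.
  + exact: fA_bounded.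
  + by case: TC.
  + by move=> g; exact: (conj_by_bicommutant Gaut phiGNS Urep Udef).
- rewrite /psiG; congr (_ * _).
  apply: inner_fixed_expectation => //; first exact: fA_bounded.
  + exact: PhiG_fixed.
  + exact: PhiG_fixed.
have EN : E M (E N y) = E N y.
  exact: (expectation_small_large Urep Ghaus (GNincr _ _ MN)) (fA_bounded _ fAy).
rewrite EN; split=> //.
exact: (expectation_large_small Urep Ghaus (GNincr _ _ MN)) (fA_bounded _ fAy).
Qed.
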